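(* Let $S$ be an idempotent semifield, let $n\geq 1$, and let $\overline{UT}_n(S)$ be the semigroup of all upper triangular $n\times n$ matrices $A$ over $S$ with $A_{i,i}\neq\mathbf{0}$ for all $i$, under matrix multiplication. Then $\overline{UT}_n(S)$ is Fountain, and each $\widetilde{\mathcal{R}}$-class and each $\widetilde{\mathcal{L}}$-class contains a unique idempotent: for $A\in\overline{UT}_n(S)$ the unique idempotent in its $\widetilde{\mathcal{R}}$-class is $A^{(+)}$ and the unique idempotent in its $\widetilde{\mathcal{L}}$-class is $A^{( * )}$.
   Context: An idempotent semifield is a commutative semiring $S$ with $x+x=x$ for all $x$, in which $S^*=S\setminus\{\mathbf{0}\}$ is an abelian group under multiplication with identity $\mathbf{1}$. The natural order is $a\leq b\iff a+b=b$; with it $S^*$ is a lattice ordered abelian group, $\mathbf{0}$ is the least element of $S$, and addition is least upper bound; $\bigwedge$ denotes greatest lower bound. For $x\in S^n$, $\mathrm{Supp}(x)$ is the set of indices of non-zero entries of $x$, and $A_{i,\star}$ is the $i$th row of $A$. For an $n\times n$ matrix $A$ over $S$ the matrix $A^{(+)}$ is defined by $$(A^{(+)})_{i,j}=\begin{cases}\bigwedge\{A_{i,k}A_{j,k}^{-1}: k\in\mathrm{Supp}(A_{j,\star})\} & \text{if } \emptyset\neq\mathrm{Supp}(A_{j,\star})\subseteq\mathrm{Supp}(A_{i,\star}),\\ \mathbf{0} & \text{otherwise.}\end{cases}$$ For upper triangular $X$, $\Delta(X)$ is the reflection of $X$ in the anti-diagonal, $\Delta(X)_{i,j}=X_{n-j+1,n-i+1}$;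 and $A^{( * )}:=\Delta\big((\Delta(A))^{(+)}\big)$. For a semigroup $T$: $a\,\widetilde{\mathcal{R}}\,b$ iff for all idempotents $e\in T$, $ea=a\Leftrightarrow eb=b$; $a\,\widetilde{\mathcal{L}}\,b$ iff for all idempotents $e\in T$, $ae=a\Leftrightarrow be=b$. $T$ is Fountain if every $\widetilde{\mathcal{R}}$-class and every $\widetilde{\mathcal{L}}$-class of $T$ contains an idempotent. *)

(* Defs.v *)
From HB Require Import structures.
From mathcomp Require Import all_boot all_order all_algebra.
From mathcomp Require Import boolp classical_sets.

Set Implicit Arguments.
Unset Strict Implicit.
Unset Printing Implicit Defensive.

Import Order.TTheory GRing.Theory.

Local Open Scope ring_scope.
Local Open Scope classical_set_scope.

(* [sinv 0] is unspecified.  As [1 != 0] in a [comNzSemiRingType], [mulVs]    *)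
(* makes the nonzero elements an abelian group under multiplication.          *)
HB.mixin Record isIdempotentSemifield S of GRing.ComNzSemiRing S := {
  sinv : S -> S;
  addss : forall x : S, x + x = x;
  mulVs : forall x : S, x != 0 -> sinv x * x = 1;
}.

#[short(type="idempotentSemifieldType")]
HB.structure Definition IdempotentSemifield :=
  { S of isIdempotentSemifield S & GRing.ComNzSemiRing S }.

(* An alias of [S] carrying its natural order [x <= y <-> x + y = y].         *)
Definition natural (S : idempotentSemifieldType) : Type := S.

Fact natural_display : Order.disp_t. Proof. exact: (Order.Disp tt tt). Qed.

Section NaturalOrder.
Variable S : idempotentSemifieldType.

Definition natural_le (x y : S) : bool := x + y == y.

Lemma natural_le_refl : reflexive natural_le.
Proof. by move=> x; rewrite /natural_le addss. Qed.

Lemma natural_le_anti : antisymmetric natural_le.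
Proof. by move=> x y /andP[/eqP xy /eqP yx]; rewrite -xy addrC. Qed.

Lemma natural_le_trans : transitive natural_le.
Proof.
by move=> y x z /eqP xy /eqP yz; apply/eqP; rewrite -yz addrA xy.
Qed.

HB.instance Definition _ := Choice.copy (natural S) S.
HB.instance Definition _ := Order.Le_isPOrder.Build natural_display (natural S)
  natural_le_refl natural_le_anti natural_le_trans.

End NaturalOrder.

Section IdempotentSemifieldTheory.
Variable S : idempotentSemifieldType.
Implicit Types x y z : S.

Local Notation "x <=s y" := ((x : natural S) <= (y : natural S))%O
  (at level 70, only parsing).

Lemma les_def x y : (x <=s y) = (x + y == y).
Proof. by []. Qed.

Lemma mulsV x : x != 0 -> x * sinv x = 1.
Proof. by rewrite mulrC; exact: mulVs. Qed.

Lemma muls_eq0 x y : (x * y == 0) = (x == 0) || (y == 0).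
Proof.
apply/eqP/idP => [xy0|/orP[]/eqP->]; [|by rewrite mul0r|by rewrite mulr0].
apply/orP; case: (eqVneq x 0) => [|x0]; [by left|right].
by rewrite -(mul1r y) -(mulVs _ x0) -mulrA xy0 mulr0.
Qed.

Lemma sinv_neq0 x : x != 0 -> sinv x != 0.
Proof.
move=> x0; apply: contra_neq (@oner_neq0 S) => xV0.
by rewrite -(mulVs _ x0) xV0 mul0r.
Qed.

Lemma les0x x : (0 <=s x).
Proof. by rewrite les_def add0r. Qed.

Lemma leDs x y z : (x + y <=s z) = (x <=s z) && (y <=s z).
Proof.
rewrite !les_def; apply/eqP/andP => [xyz|[/eqP xz /eqP yz]].
  split; first by rewrite -xyz !addrA addss.
  by rewrite -xyz [x + y]addrC !addrA addss.
by rewrite -addrA yz.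
Qed.

Lemma les_mul2l x y z : (x <=s y) -> (z * x <=s z * y).
Proof. by rewrite !les_def -mulrDr => /eqP->. Qed.

Lemma les_inv x y : x != 0 -> y != 0 -> (x <=s y) -> (sinv y <=s sinv x).
Proof.
move=> x0 y0 /(@les_mul2l _ _ (sinv x * sinv y)).
by rewrite -(mulrA _ _ y) mulVs // mulr1 mulrAC mulVs // mul1r.
Qed.

Lemma sinvK x : x != 0 -> sinv (sinv x) = x.
Proof.
move=> x0; have xV0 := sinv_neq0 x0.
by rewrite -[LHS]mulr1 -(mulVs _ x0) mulrA mulVs // mul1r.
Qed.

Lemma les_sum (I : finType) (P : {pred I}) (F : I -> S) z :
  reflect (forall k, k \in P -> (F k <=s z)) (\sum_(k in P) F k <=s z).
Proof.
apply: (iffP idP) => [le_z k Pk|le_z].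
  by move: le_z; rewrite (bigD1 k) //= leDs => /andP[].
by elim/big_ind: _ => // [|x y xz yz]; rewrite ?les0x // leDs xz.
Qed.

Lemma infimums_sinv (I : finType) (P : {pred I}) (F : I -> S) :
  (exists k, k \in P) -> (forall k, k \in P -> F k != 0) ->
  infimums [set (F k : natural S) | k in [set` P]]
    (sinv (\sum_(k in P) sinv (F k))).
Proof.
move=> [k0 Pk0] F0; set s := \sum_(k in P) _.
have le_s : forall k, k \in P -> (sinv (F k) <=s s).
  by apply/(les_sum _ (fun k => sinv (F k))); exact: lexx.
have s0 : s != 0.
  apply: contraNneq (sinv_neq0 (F0 _ Pk0)) => s0.
  by have := le_s _ Pk0; rewrite s0 les_def addr0.
split=> [_ [k /= Pk <-]|z lbz].
  by rewrite -[leRHS]sinvK ?F0//; apply: les_inv; rewrite ?sinv_neq0 ?F0 ?le_s.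
have [->|z0] := eqVneq z 0; first exact: les0x.
rewrite -[leLHS]sinvK//; apply: les_inv; rewrite ?sinv_neq0//.
apply/les_sum => k Pk; apply: les_inv; rewrite ?F0//.
by apply: lbz; exists k.
Qed.

End IdempotentSemifieldTheory.

Section PlusStar.
Variables (S : idempotentSemifieldType) (n : nat).
Implicit Types A X : 'M[S]_n.

Definition supp (x : 'rV[S]_n) : {set 'I_n} := [set k | x 0 k != 0]%SET.

(* By [infimums_sinv] the greatest lower bound below always exists, so the    *)
(* default value [0] of [infimum] is not used.                                *)
Definition plusmx A : 'M[S]_n :=
  \matrix_(i, j)
    if (supp (row j A) != finset.set0)
       && (supp (row j A) \subset supp (row i A))
    then infimum (0 : natural S)
           [set A i k * sinv (A j k) | k in [set` supp (row j A)]]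
    else 0.

Definition antidiag X : 'M[S]_n := \matrix_(i, j) X (rev_ord j) (rev_ord i).

Definition starmx A : 'M[S]_n := antidiag (plusmx (antidiag A)).

(* [is_trig_mx] means lower triangular. *)
Definition is_utbar A : bool := is_trig_mx A^T && [forall i, A i i != 0].

Record utbar := Utbar { utmx :> 'M[S]_n; utmxP : is_utbar utmx }.

HB.instance Definition _ := [isSub for utmx].
HB.instance Definition _ := [Choice of utbar by <:].

Lemma utbar_mul_subproof (A B : utbar) : is_utbar (A *m B).
Proof.
have /andP[/is_trig_mxP Aut /forallP A0] := utmxP A.
have /andP[/is_trig_mxP But /forallP B0] := utmxP B.
have {}Aut (i j : 'I_n) : (j < i)%N -> A i j = 0 by move=> /Aut; rewrite mxE.
have {}But (i j : 'I_n) : (j < i)%N -> B i j = 0 by move=> /But; rewrite mxE.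
apply/andP; split.
  apply/is_trig_mxP => i j ij; rewrite !mxE big1// => k _.
  have [kj|jk] := ltnP k j; first by rewrite Aut ?mul0r.
  by rewrite But ?mulr0 // (leq_trans ij).
apply/forallP => i; rewrite !mxE (bigD1 i) //= big1 => [|k ki].
  by rewrite addr0 muls_eq0 negb_or A0 B0.
have [lt_ki|] := ltnP k i; first by rewrite Aut ?mul0r.
by rewrite leq_eqVlt val_eqE eq_sym (negPf ki) => /But->; rewrite mulr0.
Qed.

Definition utbar_mul (A B : utbar) : utbar := Utbar (utbar_mul_subproof A B).

Lemma utbar_mulA : associative utbar_mul.
Proof. by move=> A B C; apply: val_inj; exact: mulmxA. Qed.

HB.instance Definition _ := isSemigroup.Build utbar utbar_mulA.

End PlusStar.

Section Fountain.
Variable T : semigroupType.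
Local Open Scope group_scope.
Implicit Types a b e : T.

Definition idem e : Prop := e * e = e.

Definition Rtilde a b : Prop := forall e, idem e -> (e * a = a <-> e * b = b).
Definition Ltilde a b : Prop := forall e, idem e -> (a * e = a <-> b * e = b).

Definition Rtilde_class a : set T := [set b | Rtilde a b]%classic.
Definition Ltilde_class a : set T := [set b | Ltilde a b]%classic.

Definition Fountain : Prop :=
  (forall a, exists2 e, idem e & Rtilde_class a e) /\
  (forall a, exists2 e, idem e & Ltilde_class a e).

End Fountain.

(* Main.v *)
Require Import Defs.
From mathcomp Require Import all_boot all_order all_algebra.
From mathcomp Require Import boolp classical_sets.

(** The matrix [plusmx A] is the residual of [A] by itself: when no row of [A]
    vanishes it is the largest [X] with [X *m A <= A] entrywise
    ([plusmx_residual]).  Everything else follows from this adjunction and one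
    remark: an idempotent of [utbar S n] has diagonal entries [x] with
    [x * x = x] and [x != 0], hence equal to [1], so it lies above the identity
    matrix ([idem_ge1]), and multiplying by it can only increase a matrix.

    Write [P] for [plusmx A].  Since [1 <= P] and [P *m A <= A], we get
    [P *m A = A]; then [P *m P *m A = A] gives [P *m P <= P], so [P] is
    idempotent.  If [e] is an idempotent with [e *m A = A], then
    [e *m P *m A = A], so [P <= e *m P <= P]; conversely [e *m P = P] gives
    [e *m A = e *m P *m A = A].  Hence [P] is in the class of [A]
    ([plus_Rtilde]).  Two idempotents [E] and [F] in one class satisfy
    [E *m F = F] and [F *m E = E], and as both lie above the identity,
    [E <= E *m F = F] and [F <= F *m E = E] ([Rtilde_idem_inj]).

    The left-handed half is obtained by transport along the reflection in the
    anti-diagonal, an involutive anti-automorphism of [utbar S n]. *)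

Set Implicit Arguments.
Unset Strict Implicit.
Unset Printing Implicit Defensive.

Import Order.TTheory GRing.Theory.

Local Open Scope ring_scope.

(** * The natural order on a semifield and on matrices *)

Section ScalarOrder.
Variable S : idempotentSemifieldType.
Implicit Types x y z : S.

Definition les x y : bool := ((x : natural S) <= (y : natural S))%O.

Lemma les_antisym x y : les x y -> les y x -> x = y.
Proof. by move=> xy yx; apply: (@le_anti _ (natural S)); apply/andP. Qed.

Lemma les_eq0 x : les x 0 -> x = 0.
Proof. by move=> x0; apply: les_antisym => //; exact: les0x. Qed.

Lemma les_pdivl x y z : y != 0 -> les z (x * sinv y) <-> les (z * y) x.
Proof.
move=> y0; split=> [/(les_mul2l y)|/(les_mul2l (sinv y))].
  by rewrite mulrCA mulsV // mulr1 mulrC.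
by rewrite mulrCA mulVs // mulr1 mulrC.
Qed.

Lemma les_infimum (I : finType) (P : {pred I}) (F : I -> S) z :
  (exists k, k \in P) -> (forall k, k \in P -> F k != 0) ->
  les z (infimum (0 : natural S) [set (F k : natural S) | k in [set` P]]%classic)
  <-> forall k, k \in P -> les z (F k).
Proof.
move=> P0 F0; have inf_ex := ex_intro _ _ (infimums_sinv P0 F0).
have [lb_inf ub_inf] := xgetPex (0 : natural S) inf_ex.
have [k0 Pk0] := P0; rewrite /infimum ifF; last first.
  by apply/negbTE/set0P; exists (F k0); exists k0.
split=> [z_inf k Pk|le_z]; last first.
  by apply: ub_inf => _ [k /= Pk <-]; exact: le_z.
by apply: le_trans z_inf _; apply: lb_inf; exists k.
Qed.

End ScalarOrder.

Section MatrixOrder.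
Variables (S : idempotentSemifieldType) (n : nat).
Implicit Types A B C X : 'M[S]_n.

(** Addition of matrices is entrywise supremum, so this equation is the
    entrywise order ([lemxP]); in this form, monotonicity of the product is
    distributivity. *)
Definition lemx A B : Prop := A + B = B.

Lemma lemxP A B : lemx A B <-> forall i j, les (A i j) (B i j).
Proof.
split=> [AB i j|AB]; first by rewrite /les les_def -{2}AB mxE.
by apply/matrixP => i j; rewrite mxE; apply/eqP; exact: AB.
Qed.

Lemma lemx_refl A : lemx A A.
Proof. by apply/matrixP => i j; rewrite mxE addss. Qed.

Lemma lemx_antisym A B : lemx A B -> lemx B A -> A = B.
Proof. by rewrite /lemx => AB BA; rewrite -AB addrC BA. Qed.

Lemma lemx_mull_ge1 A B : lemx 1%:M A -> lemx B (A *m B).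
Proof. by move=> A1; rewrite /lemx -{1}[B]mul1mx -mulmxDl A1. Qed.

Lemma lemx_mulr_ge1 A B : lemx 1%:M A -> lemx B (B *m A).
Proof. by move=> A1; rewrite /lemx -{1}[B]mulmx1 -mulmxDr A1. Qed.

Lemma lemx_mulP X A B :
  lemx (X *m A) B <-> forall i j k, les (X i j * A j k) (B i k).
Proof.
rewrite lemxP; split=> [XAB i j k|XAB i k].
  have := XAB i k; rewrite mxE => /(les_sum predT (fun j => X i j * A j k)).
  exact.
rewrite mxE; apply/(les_sum predT (fun j => X i j * A j k)) => j _.
exact: XAB.
Qed.

(** * The residual of a matrix by itself *)

(** Where the support condition in the definition of [plusmx] fails, some [k]
    has [A j k != 0] and [A i k = 0], which already forces [z = 0].  The
    hypothesis on row [j] is what makes this greatest [z] exist: for a zero row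
    every [z] would qualify. *)
Lemma les_plusmx A i j z : (exists k, A j k != 0) ->
  les z (plusmx A i j) <-> forall k, les (z * A j k) (A i k).
Proof.
move=> [k0 Ak0].
have suppE m k : (k \in supp (row m A)) = (A m k != 0) by rewrite inE mxE.
have supp0 : supp (row j A) != finset.set0.
  by apply/set0Pn; exists k0; rewrite suppE.
rewrite mxE supp0 /=; case: ifPn => [/fintype.subsetP sub|/fintype.subsetPn[k]].
  rewrite les_infimum; first last.
  - move=> k jk; have := sub _ jk; move: jk; rewrite !suppE => jk ik.
    by rewrite muls_eq0 negb_or ik sinv_neq0.
  - by exists k0; rewrite suppE.
  split=> le_z k; last first.
    by rewrite suppE => jk; apply/les_pdivl.
  have [->|jk] := eqVneq (A j k) 0; first by rewrite mulr0; exact: les0x.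
  by apply/les_pdivl => //; apply: le_z; rewrite suppE.
rewrite !suppE negbK => jk /eqP ik; split=> [/les_eq0-> k'|/(_ k)].
  by rewrite mul0r; exact: les0x.
rewrite ik => /les_eq0/eqP; rewrite muls_eq0 (negPf jk) orbF => /eqP->.
exact: les0x.
Qed.

Lemma plusmx_residual A X : (forall j, exists k, A j k != 0) ->
  lemx X (plusmx A) <-> lemx (X *m A) A.
Proof.
move=> A0; rewrite lemxP lemx_mulP.
split=> XA i j; first by apply/(les_plusmx _ _ (A0 j)); exact: XA.
by apply/(les_plusmx _ _ (A0 j)) => k; exact: XA.
Qed.

Section NoZeroRow.
Variables (A : 'M[S]_n) (A0 : forall j, exists k, A j k != 0).

Lemma plusmx_ge1 : lemx 1%:M (plusmx A).
Proof. by apply/plusmx_residual => //; rewrite mul1mx; exact: lemx_refl. Qed.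

Lemma plusmx_mul : plusmx A *m A = A.
Proof.
apply: lemx_antisym; first by apply/plusmx_residual => //; exact: lemx_refl.
exact/lemx_mull_ge1/plusmx_ge1.
Qed.

Lemma plusmx_absorb X :
  lemx 1%:M X -> X *m A = A <-> X *m plusmx A = plusmx A.
Proof.
move=> X1; split=> [XA|XP]; last by rewrite -plusmx_mul mulmxA XP.
apply: lemx_antisym; last exact: lemx_mull_ge1.
by apply/plusmx_residual => //; rewrite -mulmxA plusmx_mul XA; exact: lemx_refl.
Qed.

Lemma plusmx_idem : plusmx A *m plusmx A = plusmx A.
Proof. exact: (proj1 (plusmx_absorb plusmx_ge1) plusmx_mul). Qed.

End NoZeroRow.

Lemma is_utbarP A :
  reflect ((forall i j : 'I_n, (j < i)%N -> A i j = 0) /\ forall i, A i i != 0)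
          (is_utbar A).
Proof.
apply: (iffP andP) => -[Aut A0]; split.
- by move=> i j ji; have /is_trig_mxP/(_ _ _ ji) := Aut; rewrite mxE.
- exact/forallP.
- by apply/is_trig_mxP => i j ij; rewrite mxE Aut.
- exact/forallP.
Qed.

(** Below the diagonal the entry must vanish because [A j j != 0] while
    [A i j = 0] whenever [j < i]. *)
Lemma plusmx_utbar A : is_utbar A -> is_utbar (plusmx A).
Proof.
case/is_utbarP => Aut A0.
have row0 j : exists k, A j k != 0 by exists j.
apply/is_utbarP; split=> [i j ji|i].
  have /lemx_mulP/(_ i j j) : lemx (plusmx A *m A) A.
    by rewrite plusmx_mul //; exact: lemx_refl.
  rewrite (Aut _ _ ji) => /les_eq0/eqP.
  by rewrite muls_eq0 (negPf (A0 j)) orbF => /eqP.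
have /lemxP/(_ i i) := plusmx_ge1 row0; rewrite mxE eqxx mulr1n => le1.
by apply: contraNneq (oner_neq0 S) => P0; apply/eqP/les_eq0; rewrite -P0.
Qed.

End MatrixOrder.

(** * The right-handed relation *)

Section RightClasses.
Variables (S : idempotentSemifieldType) (n : nat).
Implicit Types A E F : utbar S n.

Lemma utbar_row_neq0 A j : exists k, utmx A j k != 0.
Proof. by have /is_utbarP[_ A0] := utmxP A; exists j. Qed.

Lemma utmxM A E : utmx (A * E)%g = utmx A *m utmx E.
Proof. by []. Qed.

(** By triangularity the diagonal entries multiply pointwise, so those of an
    idempotent are idempotent elements of the group of nonzero scalars. *)
Lemma idem_ge1 E : idem E -> lemx 1%:M E.
Proof.
move=> /(congr1 (@utmx S n)); rewrite utmxM => EE.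
have /is_utbarP[Eut E0] := utmxP E.
apply/lemxP => i j; rewrite mxE.
have [<-|_] := eqVneq i j; last exact: les0x.
have EEi : utmx E i i * utmx E i i = utmx E i i.
  rewrite -[RHS](congr1 (fun M : 'M[S]_n => M i i) EE) mxE (bigD1 i) //=.
  rewrite big1 ?addr0 // => k ki.
  have [lt_ki|] := ltnP k i; first by rewrite Eut ?mul0r.
  by rewrite leq_eqVlt val_eqE eq_sym (negPf ki) => /Eut->; rewrite mulr0.
have -> : utmx E i i = 1.
  by rewrite -[LHS]mul1r -(mulVs _ (E0 i)) -mulrA EEi.
exact: lexx.
Qed.

Definition plus A : utbar S n := Utbar (plusmx_utbar (utmxP A)).

Lemma plus_idem A : idem (plus A).
Proof. by apply: val_inj; exact: plusmx_idem (utbar_row_neq0 A). Qed.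

Lemma plus_Rtilde A : Rtilde A (plus A).
Proof.
move=> E /idem_ge1 E1; have absorb := plusmx_absorb (utbar_row_neq0 A) E1.
by split=> /(congr1 (@utmx S n)) EA; apply: val_inj; apply/absorb.
Qed.

Lemma Rtilde_idem_inj A E F :
  idem E -> Rtilde A E -> idem F -> Rtilde A F -> E = F.
Proof.
move=> EE AE FF AF.
have EF : (E * F = F)%g by apply/(AF _ EE)/(AE _ EE).
have FE : (F * E = E)%g by apply/(AE _ FF)/(AF _ FF).
apply: val_inj; apply: lemx_antisym.
  by rewrite -[X in lemx _ (val X)]EF; exact: lemx_mulr_ge1 (idem_ge1 FF).
by rewrite -[X in lemx _ (val X)]FE; exact: lemx_mulr_ge1 (idem_ge1 EE).
Qed.

End RightClasses.

(** * Reflection in the anti-diagonal *)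

Section Reflection.
Variables (S : idempotentSemifieldType) (n : nat).
Implicit Types A E F : utbar S n.

Lemma antidiagM (A B : 'M[S]_n) :
  antidiag (A *m B) = antidiag B *m antidiag A.
Proof.
apply/matrixP => i j; rewrite !mxE (reindex_inj rev_ord_inj).
by apply: eq_bigr => k _; rewrite !mxE mulrC.
Qed.

Lemma antidiagK : involutive (@antidiag S n).
Proof. by move=> A; apply/matrixP => i j; rewrite !mxE !rev_ordK. Qed.

Lemma antidiag_utbar (A : 'M[S]_n) : is_utbar A -> is_utbar (antidiag A).
Proof.
case/is_utbarP => Aut A0; apply/is_utbarP; split=> [i j ji|i]; rewrite mxE //.
by apply: Aut => /=; rewrite ltn_sub2l // (leq_ltn_trans _ (ltn_ord i)).
Qed.

Definition reflect_utbar A : utbar S n := Utbar (antidiag_utbar (utmxP A)).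

Lemma reflect_utbarK : involutive reflect_utbar.
Proof. by move=> A; apply: val_inj; exact: antidiagK. Qed.

Lemma reflect_utbarM A E :
  reflect_utbar (A * E)%g = (reflect_utbar E * reflect_utbar A)%g.
Proof. by apply: val_inj; exact: antidiagM. Qed.

Lemma idem_reflect E : idem E -> idem (reflect_utbar E).
Proof. by move=> EE; rewrite /idem -reflect_utbarM EE. Qed.

Lemma Ltilde_reflect A E :
  Ltilde A E <-> Rtilde (reflect_utbar A) (reflect_utbar E).
Proof.
have fixP B F : (B * F = B)%g <->
    (reflect_utbar F * reflect_utbar B = reflect_utbar B)%g.
  by rewrite -reflect_utbarM; split=> [->|/(can_inj reflect_utbarK)].
split=> AE F /idem_reflect FF; last by rewrite !fixP; exact: AE.
by have := AE _ FF; rewrite !fixP reflect_utbarK.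
Qed.

Definition star A : utbar S n := reflect_utbar (plus (reflect_utbar A)).

Lemma star_idem A : idem (star A).
Proof. exact/idem_reflect/plus_idem. Qed.

Lemma star_Ltilde A : Ltilde A (star A).
Proof. by rewrite Ltilde_reflect reflect_utbarK; exact: plus_Rtilde. Qed.

Lemma Ltilde_idem_inj A E F :
  idem E -> Ltilde A E -> idem F -> Ltilde A F -> E = F.
Proof.
move=> /idem_reflect EE /Ltilde_reflect AE /idem_reflect FF /Ltilde_reflect AF.
exact: can_inj reflect_utbarK _ _ (Rtilde_idem_inj EE AE FF AF).
Qed.

End Reflection.

Theorem corollary4p16 (S : idempotentSemifieldType) (n : nat) (hn : (0 < n)%N) :
  Fountain (utbar S n) /\
  (forall A : utbar S n,
     (exists E : utbar S n,
        utmx E = plusmx (utmx A) /\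
        unique (fun F : utbar S n => idem F /\ Rtilde_class A F) E) /\
     (exists E : utbar S n,
        utmx E = starmx (utmx A) /\
        unique (fun F : utbar S n => idem F /\ Ltilde_class A F) E)).
Proof.
split.
  split=> A; first by exists (plus A); [exact: plus_idem|exact: plus_Rtilde].
  by exists (star A); [exact: star_idem|exact: star_Ltilde].
move=> A; split.
  exists (plus A); split=> //; split=> [|F [FF AF]].
    by split; [exact: plus_idem|exact: plus_Rtilde].
  by apply: (Rtilde_idem_inj (plus_idem A) (plus_Rtilde A)).
exists (star A); split=> //; split=> [|F [FF AF]].
  by split; [exact: star_idem|exact: star_Ltilde].
by apply: (Ltilde_idem_inj (star_idem A) (star_Ltilde A)).
Qed.
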